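(* Let $\mathcal B=(S,(\Sigma,\Delta),E)$ be a specification with constructors and $G$ a set of goals. If $(\mathcal B,\mathcal F_0=\emptyset,\mathcal G_0=\lfloor G\rfloor)\Rightarrow\cdots\Rightarrow(\mathcal B,\mathcal F_n,\mathcal G_n=\emptyset)$ using the rules [Reduce] and [Derive] of the circular induction proof system, then $\mathcal B$ inductively satisfies $G$, i.e. $\mathcal B\vdash\theta[g]$ for every goal $g\in G$ and every experiment (ground constructor substitution) $\theta$ for the inductive variables of $g$.
   Context: A signature with constructors is $(S,(\Sigma,\Sigma^{ctor}))$ with $\Sigma^{ctor}\subseteq\Sigma$ the constructors; a sort is inductive if some constructor has that sort, and a variable of inductive sort is an inductive variable. A specification with constructors is $\mathcal B=(S,(\Sigma,\Delta),E)$ with $E$ a set of $\Sigma$-equations. A goal is a conditional equation $(\forall Y)(\forall Z)\,t=t'$ if $cond$, with $Y$ a set of inductive variables. Each constructor $c$ defines a derivative $\delta_c=\{\delta_{c,y}\}$: for $y\in Y$ of the sort of $c$, $\delta_{c,y}[e]$ substitutes $y$ by $c$ (if $c$ is a constant) or by $c(y_1,\dots,y_n)$ with fresh variables $y_i$ (which become inductive variables, and $y_i\sim y$ whenever $y_i$ has the same sort as $y$; $y_i$ is called an incarnation of $y$); $\Delta=\bigcup_c\delta_c$. Experiments are ground constructor substitutions for $Y$ built by composing derivatives; $\mathcal B$ inductively satisfies $e$ iff $\mathcal B\vdash\theta[e]$ for each experiment $\theta$ for $Y$. The frozen form of a variable $y{:}s$ is a distinguished constant $y.s$; the frozen form $\lfloor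 e\rfloor$ of a goal $e$ replaces its inductive variables $Y$ by their frozen constants, and $FVar(\lfloor e\rfloor)$ is the set of these frozen constants; $\lfloor G\rfloor=\{\lfloor g\rfloor\mid g\in G\}$, and derivatives act on frozen goals by $\delta_{c,y}[\lfloor e\rfloor]=\lfloor\delta_{c,y}[e]\rfloor$, $\Delta[\lfloor e\rfloor]=\lfloor\Delta[e]\rfloor$. The entailment $\vdash$ is a $\Delta$-contextual entailment system with freezing: it is reflexive ($\{e\}\vdash e$), monotone, transitive, $\Delta$-congruent (if $E\vdash e$ then $E\vdash\Delta[e]$), and satisfies (A1) $(S,\Sigma,E)\cup\lfloor F\rfloor\vdash\lfloor e\rfloor$ iff $(S,\Sigma,E)\vdash e$ when $\lfloor e\rfloor$ has no frozen variables, and (A2) if $(S,\Sigma,E)\cup\lfloor F\rfloor\vdash\lfloor G\rfloor$ then $(S,\Sigma,E)\cup\delta_c[\lfloor F\rfloor]\vdash\delta_c[\lfloor G\rfloor]$ (equational deduction satisfies these). The proof system acts on triples $(\mathcal B,\mathcal F,\mathcal G)$ with $\mathcal F$ a set of frozen hypotheses and $\mathcal G$ a set of frozen goals, via the rules [Reduce]: $(\mathcal B,\mathcal F,\mathcal G\cup\{\lfloor e\rfloor\})\Rightarrow(\mathcal B,\mathcal F,\mathcal G)$ if $\mathcal B\cup\mathcal F\vdash\lfloor e\rfloor$; [Derive]: $(\mathcal B,\mathcal F,\mathcal G\cup\{\lfloor e\rfloor\})\Rightarrow(\mathcal B,\mathcal F\cup\mathcal H(\lfloor e\rfloor,FVar(\Delta[\lfloor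 e\rfloor])),\mathcal G\cup\Delta[\lfloor e\rfloor])$ if $\mathcal B\cup\mathcal F\not\vdash\lfloor e\rfloor$, where $\mathcal H(\lfloor e\rfloor,FV)=\{\lfloor e\rfloor[y'/y]\mid y'\sim y,\ y'\in FV,\ y\in FVar(\lfloor e\rfloor)\}$. *)

(* Defs.v *)
From mathcomp Require Import all_boot.
From mathcomp Require Import boolp classical_sets functions cardinality.

Set Implicit Arguments.
Unset Strict Implicit.
Unset Printing Implicit Defensive.

Local Open Scope classical_set_scope.

Record signature := Signature {
  sort : eqType;
  op : Type;
  arity : op -> nat;
  dom : forall f : op, 'I_(arity f) -> sort;
  cod : op -> sort;
  ctor : set op }.

Section Syntax.
Variable Sg : signature.

Definition inductive_sort (a : sort Sg) : Prop :=
  exists2 c : op Sg, ctor c & cod c = a.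

(* The pair (a, n) stands for the n-th variable of sort a, and also for the   *)
(* frozen constant of that variable.                                          *)
Definition var : Type := (sort Sg * nat)%type.

(* [Frz a n] is the frozen constant of the variable [Var a n].                *)
Inductive term : sort Sg -> Type :=
| Var (a : sort Sg) (n : nat) : term a
| Frz (a : sort Sg) (n : nat) : term a
| App (f : op Sg) (ts : forall i : 'I_(arity f), term (dom i)) : term (cod f).

Definition substitution : Type := forall a : sort Sg, nat -> term a.

Fixpoint subst (sv sf : substitution) (a : sort Sg) (t : term a) : term a :=
  match t with
  | Var a n => sv a n
  | Frz a n => sf a n
  | App f ts => App (fun i => subst sv sf (ts i))
  end.

Definition upd (s : substitution) (b : sort Sg) (m : nat) (u : term b) :
    substitution :=
  fun a n =>
    match b =P a with
    | ReflectT e => if n == m then ecast a' (term a') e u else s a n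
    | ReflectF _ => s a n
    end.

Fixpoint tvars (a : sort Sg) (t : term a) : set var :=
  match t with
  | Var a n => [set (a, n)]
  | Frz _ _ => set0
  | App f ts => \bigcup_i tvars (ts i)
  end.

Fixpoint tfvars (a : sort Sg) (t : term a) : set var :=
  match t with
  | Var _ _ => set0
  | Frz a n => [set (a, n)]
  | App f ts => \bigcup_i tfvars (ts i)
  end.

Inductive ground_ctor : forall a : sort Sg, term a -> Prop :=
| Ground_ctor (c : op Sg) (ts : forall i : 'I_(arity c), term (dom i)) :
    ctor c -> (forall i, ground_ctor (ts i)) -> ground_ctor (App ts).

Record equation := Equation {
  eq_sort : sort Sg;
  lhs : term eq_sort;
  rhs : term eq_sort }.

Definition eq_subst (sv sf : substitution) (q : equation) : equation :=
  Equation (subst sv sf (lhs q)) (subst sv sf (rhs q)).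

(* (forall qvars) concl if cond, over the signature extended with the frozen  *)
(* constants; [cond] is a conjunction of equations.                           *)
Record sentence := Sentence {
  qvars : set var;
  concl : equation;
  cond : seq equation }.

Definition vars_of (q : equation) (qs : seq equation) : set var :=
  foldr (fun q' A => tvars (lhs q') `|` tvars (rhs q') `|` A) set0 (q :: qs).

Definition fvars_of (q : equation) (qs : seq equation) : set var :=
  foldr (fun q' A => tfvars (lhs q') `|` tfvars (rhs q') `|` A) set0 (q :: qs).

Definition FVar (s : sentence) : set var := fvars_of (concl s) (cond s).

Definition occ (s : sentence) : set var :=
  qvars s `|` vars_of (concl s) (cond s) `|` FVar s.

Definition sigma_equation (s : sentence) : Prop :=
  vars_of (concl s) (cond s) `<=` qvars s /\ FVar s = set0.

(* (forall indv) (forall genv) gconcl if gcond                                *)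
Record goal := Goal {
  indv : set var;
  genv : set var;
  gconcl : equation;
  gcond : seq equation }.

(* The sorts of [indv] are not constrained here: all the fresh variables of a *)
(* derivative join [indv], whatever their sorts.                              *)
Definition wf_goal (g : goal) : Prop :=
  [/\ finite_set (indv g), finite_set (genv g), indv g `&` genv g = set0,
      vars_of (gconcl g) (gcond g) `<=` indv g `|` genv g
    & fvars_of (gconcl g) (gcond g) = set0].

Definition inductive_goal (g : goal) : Prop :=
  wf_goal g /\ forall x, indv g x -> inductive_sort x.1.

Definition as_sentence (g : goal) : sentence :=
  Sentence (indv g `|` genv g) (gconcl g) (gcond g).

Definition on_indv (g : goal) (s : substitution) : substitution :=
  fun a n => if (a, n) \in indv g then s a n else Var a n.

(* [inst s g] replaces the inductive variables of g and leaves (forall genv). *)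
Definition inst (s : substitution) (g : goal) : sentence :=
  Sentence (genv g) (eq_subst (on_indv g s) Frz (gconcl g))
    (map (eq_subst (on_indv g s) Frz) (gcond g)).

Definition freeze (g : goal) : sentence := inst Frz g.

Definition frozen_goal (s : sentence) : Prop :=
  exists2 g, wf_goal g & s = freeze g.

Definition experiment (g : goal) (th : substitution) : Prop :=
  forall a n, indv g (a, n) -> ground_ctor (th a n).

Definition fresh (c : op Sg) (ys : 'I_(arity c) -> nat) (A : set var) : Prop :=
  injective (fun i => (dom i, ys i) : var) /\ forall i, ~ A (dom i, ys i).

(* The derivative delta_{c,y} with fresh variables ys, on goals ([gderiv])    *)
(* and on frozen goals ([deriv]); y is the name of a variable of sort cod c.  *)
(* See [freeze_gderiv]. Being a substitution, [deriv] fixes the sentences in  *)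
(* which the frozen constant of y does not occur.                             *)
Definition gderiv (c : op Sg) (y : nat) (ys : 'I_(arity c) -> nat) (g : goal) :
    goal :=
  let d := eq_subst (upd Var y (App (fun i => Var (dom i) (ys i)))) Frz in
  Goal (indv g `\ (cod c, y) `|` range (fun i => (dom i, ys i) : var)) (genv g)
    (d (gconcl g)) (map d (gcond g)).

Definition fsubst (s : substitution) (e : sentence) : sentence :=
  Sentence (qvars e) (eq_subst Var s (concl e)) (map (eq_subst Var s) (cond e)).

Definition deriv (c : op Sg) (y : nat) (ys : 'I_(arity c) -> nat) :
    sentence -> sentence :=
  fsubst (upd Frz y (App (fun i => Frz (dom i) (ys i)))).

Lemma upd_eq (s : substitution) b m (u : term b) : upd s m u b m = u.
Proof.
rewrite /upd; case: eqP => // e; rewrite eqxx.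
by rewrite (eq_irrelevance e erefl).
Qed.

Lemma upd_neq (s : substitution) b m (u : term b) a n :
  (a, n) <> (b, m) -> upd s m u a n = s a n.
Proof.
move=> ne; rewrite /upd; case: eqP => // e; case: eqP => // en.
by case: ne; rewrite e en.
Qed.

Lemma freeze_gderiv (c : op Sg) (y : nat) (ys : 'I_(arity c) -> nat) (g : goal) :
  wf_goal g -> indv g (cod c, y) -> fresh ys (indv g `|` genv g) ->
  freeze (gderiv y ys g) = deriv y ys (freeze g).
Proof.
case=> _ _ dYZ sv sf gy [_ fr].
set g' := gderiv y ys g.
set u := upd Var y (App (fun i => Var (dom i) (ys i))).
set v := upd Frz y (App (fun i => Frz (dom i) (ys i))).
have tE a (t : term a) : tvars t `<=` indv g `|` genv g -> tfvars t = set0 ->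
    subst (on_indv g' Frz) Frz (subst u Frz t) =
    subst Var v (subst (on_indv g Frz) Frz t).
  elim: t => [b n|b n|f ts IH] /= tv tf.
  - have [[e1 e2]|ne] := pselect ((b, n) = (cod c, y)).
      move: b n e1 e2 tv tf => b n -> -> _ _.
      rewrite /u upd_eq /= {2}/on_indv mem_set //= /v upd_eq.
      congr App; apply: functional_extensionality_dep => i.
      by rewrite /on_indv mem_set //=; right; exists i.
    rewrite /u upd_neq //= /on_indv.
    have -> : ((b, n) \in indv g') = ((b, n) \in indv g).
      apply/idP/idP => /set_mem h; apply/mem_set.
        by case: h => [[]//|[i _ ei]]; case: (fr i); rewrite ei; exact: tv.
      by left; split.
    by case: ifP => //= _; rewrite /v upd_neq.
  - by have : (set0 : set var) (b, n) by rewrite -tf.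
  - congr App; apply: functional_extensionality_dep => i; apply: IH.
      by move=> x hx; apply: tv; exists i.
    by apply/seteqP; split=> // x hx; rewrite -tf; exists i.
have qE q qs : vars_of q qs `<=` indv g `|` genv g -> fvars_of q qs = set0 ->
    eq_subst (on_indv g' Frz) Frz (eq_subst u Frz q) =
    eq_subst Var v (eq_subst (on_indv g Frz) Frz q).
  move=> tv tf; rewrite /eq_subst /=; congr Equation; apply: tE.
  - by move=> x hx; apply: tv; left; left.
  - by apply/seteqP; split=> // x hx; rewrite -tf; left; left.
  - by move=> x hx; apply: tv; left; right.
  - by apply/seteqP; split=> // x hx; rewrite -tf; left; right.
have qsE qs : foldr (fun q' A => tvars (lhs q') `|` tvars (rhs q') `|` A)
      set0 qs `<=` indv g `|` genv g ->
    foldr (fun q' A => tfvars (lhs q') `|` tfvars (rhs q') `|` A)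
      set0 qs = set0 ->
    map (eq_subst (on_indv g' Frz) Frz) (map (eq_subst u Frz) qs) =
    map (eq_subst Var v) (map (eq_subst (on_indv g Frz) Frz) qs).
  elim: qs => //= q qs IH tv tf; rewrite (qE q qs) // IH //.
    by move=> x hx; apply: tv; right.
  by apply/seteqP; split=> // x hx; rewrite -tf; right.
rewrite /freeze /inst /deriv /fsubst /=; congr Sentence.
  exact: (qE _ (gcond g)).
apply: qsE.
  by move=> x hx; apply: sv; right.
by apply/seteqP; split=> // x hx; rewrite -sf; right.
Qed.

(* e[y'/y] on frozen constants of sort a                                      *)
Definition rename (a : sort Sg) (y' y : nat) : sentence -> sentence :=
  fsubst (upd Frz y (Frz a y')).

(* [nu c y] is the choice of fresh variables made by delta_{c,y}. It has to   *)
(* be a function: with all the choices at once, Delta[e] would be infinite.   *)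
Definition name_choice : Type := forall c : op Sg, nat -> 'I_(arity c) -> nat.

Definition fresh_choice (nu : name_choice) (e : sentence) : Prop :=
  forall c y, ctor c -> FVar e (cod c, y) -> fresh (nu c y) (occ e).

(* There is nothing to substitute in a sentence without frozen constants,     *)
(* which is then its own derivative. The empty set instead would let the rule *)
(* [Derive] discard any such goal that is not provable.                       *)
Definition Delta (nu : name_choice) (e : sentence) : set sentence :=
  [set e' | exists c y,
     [/\ ctor c, FVar e (cod c, y) & e' = deriv y (nu c y) e]]
  `|` [set e' | FVar e = set0 /\ e' = e].

(* The relation y' ~ y is oriented: y' is an incarnation of y.                *)
Definition incarnation (nu : name_choice) (y' y : var) : Prop :=
  exists (c : op Sg) (m : nat) (i : 'I_(arity c)),
    [/\ ctor c, y = (cod c, m), y' = (dom i, nu c m i) & dom i = cod c].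

Definition hypotheses (nu : name_choice) (e : sentence) (FV : set var) :
    set sentence :=
  [set e' | exists (a : sort Sg) (y' y : nat),
     [/\ incarnation nu (a, y') (a, y), FV (a, y'), FVar e (a, y)
       & e' = rename a y' y e]].

(* In [ent_A1] the hypotheses F all contain frozen constants, as the members  *)
(* of [hypotheses] do. Without this restriction F = {e} together with         *)
(* [ent_refl] and [ent_mono] would prove every e with no inductive variable.  *)
(* [ent_congr] is about unfrozen goals; [ent_A2] holds for each member        *)
(* delta_{c,y} of delta_c, with the same fresh variables throughout F and G.  *)
Record contextual_entailment (ent : set sentence -> sentence -> Prop) : Prop :=
  ContextualEntailment {
    ent_refl : forall e, ent [set e] e;
    ent_mono : forall E E' e, E `<=` E' -> ent E e -> ent E' e;
    ent_trans : forall E E' e,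
      (forall e', E' e' -> ent E e') -> ent E' e -> ent E e;
    ent_congr : forall E g c y (ys : 'I_(arity c) -> nat),
      E `<=` sigma_equation -> wf_goal g ->
      ctor c -> indv g (cod c, y) -> fresh ys (indv g `|` genv g) ->
      ent E (as_sentence g) -> ent E (as_sentence (gderiv y ys g));
    ent_A1 : forall E F g,
      E `<=` sigma_equation ->
      F `<=` frozen_goal -> (forall f, F f -> FVar f !=set0) ->
      wf_goal g -> indv g = set0 ->
      (ent (E `|` F) (freeze g) <-> ent E (as_sentence g));
    ent_A2 : forall E F G c y (ys : 'I_(arity c) -> nat),
      E `<=` sigma_equation -> F `<=` frozen_goal -> G `<=` frozen_goal ->
      ctor c -> fresh ys (\bigcup_(e in F `|` G) occ e) ->
      (forall e, G e -> ent (E `|` F) e) ->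
      forall e, (deriv y ys @` G) e -> ent (E `|` deriv y ys @` F) e }.

End Syntax.

Arguments Var {Sg} a n.
Arguments Frz {Sg} a n.

Record specification := Specification {
  sig :> signature;
  eqns : set (sentence sig);
  eqnsP : eqns `<=` @sigma_equation sig }.

Section ProofSystem.
Variables (B : specification) (ent : set (sentence B) -> sentence B -> Prop).

(* (F, G): the frozen hypotheses and the frozen goals                         *)
Definition config : Type := (set (sentence B) * set (sentence B))%type.

Inductive step : config -> config -> Prop :=
| Reduce F G e :
    ent (eqns (s := B) `|` F) e ->
    step (F, G `|` [set e]) (F, G)
| Derive F G e (nu : name_choice B) :
    fresh_choice nu e ->
    ~ ent (eqns (s := B) `|` F) e ->
    step (F, G `|` [set e])
         (F `|` hypotheses nu e (\bigcup_(e' in Delta nu e) FVar e'),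
          G `|` Delta nu e).

Inductive steps : config -> config -> Prop :=
| Steps_refl C : steps C C
| Steps_step C C' C'' : step C C' -> steps C' C'' -> steps C C''.

Definition inductively_satisfies (g : goal B) : Prop :=
  forall th, experiment g th -> ent (eqns (s := B)) (inst th g).

End ProofSystem.

(* Main.v *)
Require Import Defs.
From mathcomp Require Import all_boot.
From mathcomp Require Import boolp classical_sets functions cardinality.

Set Implicit Arguments.
Unset Strict Implicit.
Unset Printing Implicit Defensive.

Local Open Scope classical_set_scope.

(* Every ground instance of every goal met in the run is provable, by induction
   on the total size of the terms substituted for its frozen constants.
   - If the goal was derived, the instance is a strictly smaller instance of one
     of its derivatives.
   - If the goal was reduced, (A2) applied repeatedly instantiates its entailment
     from B and the final hypotheses. The instantiated hypotheses that still
     contain frozen constants are dropped by (A1). Each of the others is an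
     instance, of no larger size, of a derived goal, so it falls under the first
     case.
   (A2) needs names that are fresh for all the hypotheses at once; they exist
   because all the sets of goals of the run are finite. *)

(** * Substitutions for frozen constants *)

Section FrozenSubstitution.
Variable Sg : signature.
Implicit Types (s r : substitution Sg) (e : sentence Sg) (q : equation Sg).

Definition subst_then r s : substitution Sg := fun a n => subst Var s (r a n).

Lemma subst_comp r s a (t : term a) :
  subst Var s (subst Var r t) = subst Var (subst_then r s) t.
Proof.
elim: t => //= f ts IH; congr App.
by apply: functional_extensionality_dep => i; exact: IH.
Qed.

Lemma eq_in_subst r s a (t : term a) :
  (forall b n, tfvars t (b, n) -> r b n = s b n) -> subst Var r t = subst Var s t.
Proof.
elim: t => [//|b n|f ts IH] /= rs; first exact: rs.
congr App; apply: functional_extensionality_dep => i; apply: IH => b n h.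
by apply: rs; exists i.
Qed.

Lemma tfvars_subst s a (t : term a) x :
  tfvars (subst Var s t) x <->
  exists b n, tfvars t (b, n) /\ tfvars (s b n) x.
Proof.
elim: t => [b n|b n|f ts IH] /=; split.
- by [].
- by case=> [? [? []]].
- by exists b, n.
- by case=> [b' [n' [[-> ->]]]].
- by case=> i _ /IH[b [n [h1 h2]]]; exists b, n; split=> //; exists i.
- by case=> [b [n [[i _ h1] h2]]]; exists i => //; apply/IH; exists b, n.
Qed.

Lemma tvars_subst s a (t : term a) :
  (forall b n, tvars (s b n) = set0) -> tvars (subst Var s t) = tvars t.
Proof.
move=> s0; elim: t => [//|b n|f ts IH] /=; first exact: s0.
by congr bigcup; apply: funext => i; exact: IH.
Qed.

Lemma tfvars_finite a (t : term (Sg := Sg) a) : finite_set (tfvars t).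
Proof.
elim: t => [b n|b n|f ts IH] /=; [exact: finite_set0|exact: finite_set1|].
by apply: bigcup_finite => [|i _]; [exact: finite_finset|exact: IH].
Qed.

Lemma fsubst_comp r s e : fsubst s (fsubst r e) = fsubst (subst_then r s) e.
Proof.
have qE q : eq_subst Var s (eq_subst Var r q) = eq_subst Var (subst_then r s) q.
  by rewrite /eq_subst /= !subst_comp.
rewrite /fsubst /= qE -map_comp; congr Sentence; apply: eq_map => q; exact: qE.
Qed.

Lemma eq_in_fsubst r s e :
  (forall b n, FVar e (b, n) -> r b n = s b n) -> fsubst r e = fsubst s e.
Proof.
rewrite /FVar /fvars_of /fsubst; case: e => V q qs /= rs.
have qE q' : (forall b n, (tfvars (lhs q') `|` tfvars (rhs q')) (b, n) ->
    r b n = s b n) -> eq_subst Var r q' = eq_subst Var s q'.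
  move=> h; rewrite /eq_subst; congr Equation; apply: eq_in_subst => b n hb.
    by apply: h; left.
  by apply: h; right.
congr Sentence; first by apply: qE => b n h; apply: rs; left.
have {rs} : forall b n, foldr (fun q' A => tfvars (lhs q') `|` tfvars (rhs q') `|` A)
    set0 qs (b, n) -> r b n = s b n by move=> b n h; apply: rs; right.
elim: qs => //= q' qs IH rs; rewrite qE ?IH // => b n h; apply: rs.
  by right.
by left.
Qed.

Lemma FVar_fsubst s e x :
  FVar (fsubst s e) x <-> exists b n, FVar e (b, n) /\ tfvars (s b n) x.
Proof.
rewrite /FVar /fvars_of /fsubst; case: e => V q qs.
rewrite [concl _]/= [cond _]/= [concl _]/= [cond _]/= -map_cons.
elim: (q :: qs) => {q qs} [|q qs IH]; first by split => [//|[? [? []]]].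
rewrite [map _ _]/= [foldr _ _ _]/= [foldr _ _ (q :: qs)]/=; split.
  case=> [[]|] => [/tfvars_subst|/tfvars_subst|/IH] [b [n [h1 h2]]];
    exists b, n; split=> //; by [left; left|left; right|right].
case=> b [n [[[h1|h1]|h1] h2]].
- by left; left; apply/tfvars_subst; exists b, n.
- by left; right; apply/tfvars_subst; exists b, n.
- by right; apply/IH; exists b, n.
Qed.

Lemma vars_of_fsubst s e : (forall b n, tvars (s b n) = set0) ->
  vars_of (concl (fsubst s e)) (cond (fsubst s e)) = vars_of (concl e) (cond e).
Proof.
move=> s0; rewrite /vars_of /fsubst; case: e => V q qs.
rewrite [concl _]/= [cond _]/= [concl _]/= [cond _]/= -map_cons.
elim: (q :: qs) => {q qs} [//|q qs IH].
by rewrite [map _ _]/= [foldr _ _ _]/= [foldr _ _ (q :: qs)]/= IH !tvars_subst.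
Qed.

Lemma FVar_finite e : finite_set (FVar e).
Proof.
rewrite /FVar /fvars_of; elim: (concl e :: cond e) => [|q qs IH] /=.
  exact: finite_set0.
by rewrite !finite_setU; do 2?split => //; exact: tfvars_finite.
Qed.

(** Since [g] has no frozen constants of its own, those of [freeze g] come exactly from its
    inductive variables. Experiments can therefore be studied on frozen goals alone. *)
Lemma inst_fsubst s (g : goal Sg) : wf_goal g -> inst s g = fsubst s (freeze g).
Proof.
case=> _ _ _ _ f0; rewrite /freeze /inst /fsubst /=.
have tE a (t : term a) : tfvars t = set0 ->
    subst (on_indv g s) Frz t = subst Var s (subst (on_indv g Frz) Frz t).
  elim: t => [b n|b n|f ts IH] /= tf.
  - by rewrite /on_indv; case: ifP.
  - by have : (set0 : set (var Sg)) (b, n) by rewrite -tf.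
  - congr App; apply: functional_extensionality_dep => i; apply: IH.
    by apply/seteqP; split=> // x hx; rewrite -tf; exists i.
have qE q : tfvars (lhs q) `|` tfvars (rhs q) = set0 ->
    eq_subst (on_indv g s) Frz q = eq_subst Var s (eq_subst (on_indv g Frz) Frz q).
  by rewrite setU_eq0 => -[h1 h2]; rewrite /eq_subst /= -!tE.
move: f0; rewrite /fvars_of /= setU_eq0 => -[/qE -> f0]; congr Sentence.
elim: (gcond g) f0 => //= q qs IH; rewrite setU_eq0 => -[/qE -> h].
by rewrite IH.
Qed.

Lemma FVar_freeze (g : goal Sg) : wf_goal g ->
  FVar (freeze g) = indv g `&` vars_of (gconcl g) (gcond g).
Proof.
case=> _ _ _ _; rewrite /FVar /freeze /inst /fvars_of /vars_of.
rewrite [concl _]/= [cond _]/= -map_cons => f0.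
have tE a (t : term a) : tfvars t = set0 ->
    tfvars (subst (on_indv g Frz) Frz t) = indv g `&` tvars t.
  elim: t => [b n|b n|f ts IH] /= tf.
  - rewrite /on_indv; case: ifPn => /=; [move=> /set_mem h|rewrite notin_setE => h].
      by apply/seteqP; split=> x /=; [move=> ->|case].
    by apply/seteqP; split=> x //= [h1 h2]; apply: h; rewrite -h2.
  - by have : (set0 : set (var Sg)) (b, n) by rewrite -tf.
  - rewrite setI_bigcupr; apply: eq_bigcupr => i _; apply: IH.
    by apply/seteqP; split=> // x hx; rewrite -tf; exists i.
elim: (gconcl g :: gcond g) f0 => [_|q qs IH] /=; first by rewrite setI0.
by rewrite !setU_eq0 => -[[h1 h2] h3]; rewrite !tE // IH // !setIUr.
Qed.

Lemma vars_of_freeze (g : goal Sg) :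
  vars_of (concl (freeze g)) (cond (freeze g)) =
  vars_of (gconcl g) (gcond g) `\` indv g.
Proof.
rewrite /freeze /inst /vars_of.
have tE a (t : term a) :
    tvars (subst (on_indv g Frz) Frz t) = tvars t `\` indv g.
  elim: t => [b n|b n|f ts IH] /=.
  - rewrite /on_indv; case: ifPn => /=; [move=> /set_mem h|rewrite notin_setE => h].
      by apply/seteqP; split=> x //= [-> []].
    by apply/seteqP; split=> x /=; [move=> ->|case].
  - by rewrite set0D.
  - by rewrite setD_bigcupl; apply: eq_bigcupr => i _; apply: IH.
rewrite [concl _]/= [cond _]/= -map_cons.
elim: (gconcl g :: gcond g) => [|q qs IH] /=; first by rewrite set0D.
by rewrite !tE IH !setDUl.
Qed.

(** This criterion mentions no goal, so it can be checked after a substitution. Conversely, a goal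
    is recovered by turning each frozen constant back into its variable, which clashes with no
    quantified variable because the two sets of names are disjoint. *)
Lemma frozen_goalP e : frozen_goal e <->
  [/\ finite_set (qvars e), vars_of (concl e) (cond e) `<=` qvars e
    & FVar e `<=` ~` qvars e].
Proof.
split.
  case=> g gwf ->; rewrite FVar_freeze // vars_of_freeze.
  case: gwf => _ fin dis vs _; split=> //= x.
    by case=> /vs[].
  move=> -[xi _] xg; have : (indv g `&` genv g) x by [].
  by rewrite dis.
case=> fin vs dis.
(* Unfreezing: the second [Var] sends a frozen constant to the variable of the same name. *)
pose u := @subst Sg Var Var; pose uq q := @eq_subst Sg Var Var q.
pose g := Goal (FVar e) (qvars e) (uq (concl e)) (map uq (cond e)).
have uE a (t : term a) : tvars t `<=` qvars e -> tfvars t `<=` FVar e ->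
    subst (on_indv g Frz) Frz (u a t) = t.
  rewrite /u; elim: t => [b n|b n|f ts IH] /= tv tf.
  - rewrite /on_indv; case: ifPn => //= /set_mem /dis []; exact: tv.
  - by rewrite /on_indv mem_set //=; exact: tf.
  - congr App; apply: functional_extensionality_dep => i; apply: IH => x h.
      by apply: tv; exists i.
    by apply: tf; exists i.
have uv a (t : term a) : tvars (u a t) = tvars t `|` tfvars t.
  rewrite /u; elim: t => [b n|b n|f ts IH] /=; rewrite ?setU0 ?set0U //.
  by rewrite -bigcupU; apply: eq_bigcupr => i _; exact: IH.
have uf a (t : term a) : tfvars (u a t) = set0.
  by rewrite /u; elim: t => //= f ts IH; exact: bigcup0.
have uqE q : tvars (lhs q) `|` tvars (rhs q) `<=` qvars e ->
    tfvars (lhs q) `|` tfvars (rhs q) `<=` FVar e ->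
    eq_subst (on_indv g Frz) Frz (uq q) = q.
  rewrite !subUset => -[h1 h2] [h3 h4]; rewrite /uq /eq_subst /=.
  by rewrite !uE //; case: q {h1 h2 h3 h4}.
exists g; last first.
  rewrite /freeze /inst /=.
  have qsE qs : foldr (fun q' A => tvars (lhs q') `|` tvars (rhs q') `|` A)
        set0 qs `<=` qvars e ->
      foldr (fun q' A => tfvars (lhs q') `|` tfvars (rhs q') `|` A)
        set0 qs `<=` FVar e ->
      map (eq_subst (on_indv g Frz) Frz) (map uq qs) = qs.
    elim: qs => //= q qs IH; rewrite !(subUset _ (_ `|` _)) => -[h1 h2] [h3 h4].
    by rewrite uqE // IH.
  have sF : FVar e `<=` FVar e by [].
  move: vs sF; rewrite {1}/FVar /vars_of /fvars_of.
  rewrite /= !(subUset _ (_ `|` _)) => -[h1 h2] [h3 h4].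
  by rewrite uqE // qsE //; case: (e).
split=> //=.
- exact: FVar_finite.
- by apply/seteqP; split=> x //= -[/dis].
- apply: subset_trans (_ : FVar e `|` vars_of (concl e) (cond e) `<=` _).
    rewrite /FVar /fvars_of /vars_of -map_cons.
    elim: (concl e :: cond e) => //= q qs IH; rewrite !uv.
    move=> x [[[h|h]|[h|h]]|/IH[h|h]];
    by [right; left; left|left; left; left|right; left; right|left; left; right
       |left; right|right; right].
  by move=> x [h|/vs]; [left|right].
- rewrite /fvars_of -map_cons.
  by elim: (concl e :: cond e) => //= q qs IH; rewrite !uf IH !setU0.
Qed.

Lemma frozen_goal_fsubst s e :
  frozen_goal e -> (forall b n, tvars (s b n) = set0) ->
  (forall b n, FVar e (b, n) -> tfvars (s b n) `<=` ~` qvars e) ->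
  frozen_goal (fsubst s e).
Proof.
move=> /frozen_goalP[fin vs dis] s0 sq; apply/frozen_goalP; split=> //.
  by rewrite vars_of_fsubst.
by move=> x /FVar_fsubst[b [n [/sq h1 /h1]]].
Qed.

(** A view for case analysis on [upd] that hides the cast along the equality of sorts. *)
Variant upd_spec s b m (u : term b) : forall a, nat -> term a -> Prop :=
| Upd_same : upd_spec s m u m u
| Upd_other a n : (a, n) <> (b, m) -> upd_spec s m u n (s a n).

Lemma updP s b m (u : term b) a n : upd_spec s m u n (upd s m u a n).
Proof.
have [[ea en]|ne] := pselect ((a, n) = (b, m)).
  by move: a n ea en => a n -> ->; rewrite upd_eq; constructor.
by rewrite upd_neq //; constructor.
Qed.

Lemma occ_fsubst s e x : (forall b n, tvars (s b n) = set0) ->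
  occ (fsubst s e) x ->
  occ e x \/ exists b n, FVar e (b, n) /\ tfvars (s b n) x.
Proof.
move=> s0; rewrite /occ vars_of_fsubst // => -[[h|h]|/FVar_fsubst h].
- by left; left; left.
- by left; left; right.
- by right.
Qed.

Lemma fsubst_Frz e : fsubst Frz e = e.
Proof.
have tE a (t : term (Sg := Sg) a) : subst Var Frz t = t.
  elim: t => //= f ts IH; congr App.
  by apply: functional_extensionality_dep => i; exact: IH.
have qE q : eq_subst Var Frz q = q by rewrite /eq_subst !tE; case: q.
by case: e => V q qs; rewrite /fsubst /= qE; under eq_map do rewrite qE; rewrite map_id.
Qed.

Lemma ground_ctor_closed a (t : term (Sg := Sg) a) :
  ground_ctor t -> tvars t = set0 /\ tfvars t = set0.
Proof.
by elim=> c ts _ _ IH /=; split; apply: bigcup0 => i _; case: (IH i).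
Qed.

(** * Instantiating the fresh names of a derivative *)

Definition upds s (c : op Sg) (ys : 'I_(arity c) -> nat)
    (ts : forall i : 'I_(arity c), term (dom i)) : substitution Sg :=
  foldr (fun i r => upd r (ys i) (ts i)) s (enum 'I_(arity c)).

Lemma upds_in s (c : op Sg) ys (ts : forall i : 'I_(arity c), term (dom i)) i :
  injective (fun i => (dom i, ys i) : var Sg) ->
  upds s ys ts (dom i) (ys i) = ts i.
Proof.
move=> inj; rewrite /upds; have : i \in enum 'I_(arity c) by rewrite mem_enum.
elim: (enum _) => //= j js IH; rewrite inE.
have [->|ne /= ij] := eqVneq i j; first by rewrite upd_eq.
by rewrite upd_neq ?IH // => /(inj i j) eij; rewrite eij eqxx in ne.
Qed.

Lemma upds_out s (c : op Sg) ys (ts : forall i : 'I_(arity c), term (dom i)) b n :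
  (forall i, (dom i, ys i) <> (b, n) :> var Sg) -> upds s ys ts b n = s b n.
Proof.
move=> out; rewrite /upds; elim: (enum _) => //= j js IH.
by rewrite upd_neq //; apply/nesym.
Qed.

(** The derivative supplies the head constructor of [s (cod c) y], and the fresh names receive its
    arguments. Freshness keeps [upds] from disturbing the other constants of [e]. *)
Lemma deriv_upds s (c : op Sg) y ys (ts : forall i : 'I_(arity c), term (dom i)) e :
  fresh ys (occ e) -> s (cod c) y = App ts ->
  fsubst (upds s ys ts) (deriv y ys e) = fsubst s e.
Proof.
move=> [inj out] sy; rewrite fsubst_comp; apply: eq_in_fsubst => b n.
rewrite /subst_then.
case: updP => [_|{}b {}n _ bn] /=.
  rewrite sy; congr App; apply: functional_extensionality_dep => i.
  exact: upds_in.
by apply: upds_out => i eb; case: (out i); rewrite eb; right.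
Qed.

Definition frozen_app (c : op Sg) (ys : 'I_(arity c) -> nat) : term (cod c) :=
  App (fun i => Frz (dom i) (ys i)).

Lemma tvars_deriv (c : op Sg) y (ys : 'I_(arity c) -> nat) b n :
  tvars (upd Frz y (frozen_app ys) b n) = set0.
Proof. by case: updP => //=; exact: bigcup0. Qed.

Lemma tfvars_deriv (c : op Sg) y (ys : 'I_(arity c) -> nat) b n x :
  tfvars (upd Frz y (frozen_app ys) b n) x ->
  x = (b, n) \/ exists i, x = (dom i, ys i).
Proof.
case: updP => [|{}b {}n _] /=; last by left.
by case=> i _ ->; right; exists i.
Qed.

Lemma frozen_goal_deriv (c : op Sg) y (ys : 'I_(arity c) -> nat) e :
  frozen_goal e -> fresh ys (occ e) -> frozen_goal (deriv y ys e).
Proof.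
move=> fe [_ out]; apply: frozen_goal_fsubst => // [|b n eb x].
  exact: tvars_deriv.
case/tfvars_deriv => [->|[i ->] qi]; last by apply: (out i); left; left.
by case/frozen_goalP: fe => _ _; exact.
Qed.

Lemma frozen_goal_rename a y' y e :
  frozen_goal e -> ~ qvars e (a, y') -> frozen_goal (rename a y' y e).
Proof.
move=> fe out; apply: frozen_goal_fsubst => // b n; case: updP => //=.
  by move=> _ x ->.
by move=> {}b {}n _ eb x ->; case/frozen_goalP: fe => _ _; exact.
Qed.

(** * Grounding substitutions and bounds on names *)

Definition grounding s : Prop := forall a n, s a n = Frz a n \/ ground_ctor (s a n).

Lemma grounding_tvars s b n : grounding s -> tvars (s b n) = set0.
Proof. by move=> /(_ b n) [->|/ground_ctor_closed[]]. Qed.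

Lemma grounding_tfvars s b n x : grounding s -> tfvars (s b n) x -> x = (b, n).
Proof. by move=> /(_ b n) [->|/ground_ctor_closed[_ ->]]. Qed.

Lemma frozen_goal_grounding s e :
  grounding s -> frozen_goal e -> frozen_goal (fsubst s e).
Proof.
move=> gs fe; apply: frozen_goal_fsubst => // [b n|b n eb x].
  exact: grounding_tvars.
by move=> /(grounding_tfvars gs) ->; case/frozen_goalP: fe => _ _; exact.
Qed.

(** Ground constructor terms are closed, so bounds on names survive instantiation. *)
Lemma occ_grounding s e : grounding s -> occ (fsubst s e) `<=` occ e.
Proof.
move=> gs x /occ_fsubst[] //; first by move=> b n; exact: grounding_tvars.
by case=> b [n [eb /(grounding_tfvars gs) ->]]; right.
Qed.

Lemma grounding_upd m a (u : term a) : ground_ctor u -> grounding (upd Frz m u).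
Proof. by move=> gu b n; case: updP; [right|left]. Qed.

(** The finite support makes it possible to substitute one constant at a time. *)
Definition restrict s (l : seq (Defs.sort Sg * nat)) : substitution Sg :=
  fun a n => if (a, n) \in l then s a n else Frz a n.

(** Sequential and simultaneous substitution agree because [s a n] is closed: the later
    substitutions leave it unchanged. *)
Lemma restrict_cons s a n l : ground_ctor (s a n) ->
  subst_then (upd Frz n (s a n)) (restrict s l) = restrict s ((a, n) :: l).
Proof.
move=> gs; apply: functional_extensionality_dep => b.
apply: functional_extensionality_dep => m; rewrite /subst_then.
case: updP => [|{}b {}m /eqP ne]; last by rewrite /restrict inE (negPf ne).
rewrite /restrict inE eqxx /=.
elim: gs => c ts _ _ IH /=; congr App.
by apply: functional_extensionality_dep => i; exact: IH.
Qed.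

(** Under such a bound, every name from [N] on is fresh for all of [X] at once, whatever its
    sort. *)
Definition names_below N (X : set (sentence Sg)) : Prop :=
  forall e, X e -> forall x, occ e x -> x.2 < N.

Lemma finite_names_below (A : set (var Sg)) :
  finite_set A -> exists N, forall x, A x -> x.2 < N.
Proof.
move=> /(@finite_seqP (Defs.sort Sg * nat)%type)[l ->].
exists (\max_(x <- l) x.2).+1 => x /= xl.
by rewrite ltnS (big_rem x) //= leq_maxl.
Qed.

Lemma frozen_goal_occ_finite e : frozen_goal e -> finite_set (occ e).
Proof.
case/frozen_goalP => fin vs _.
apply: sub_finite_set (_ : occ e `<=` qvars e `|` FVar e) _.
  by move=> x [[h|/vs h]|h]; by [left|right].
by rewrite finite_setU; split=> //; exact: FVar_finite.
Qed.

(** * Instantiating an entailment by ground constructor terms *)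

Section Entailment.
Variables (ent : set (sentence Sg) -> sentence Sg -> Prop).
Hypothesis entP : contextual_entailment ent.
Variable E : set (sentence Sg).
Hypothesis EP : E `<=` @sigma_equation Sg.

(** The quantification over [F] and [e] allows iteration, each substitution acting on hypotheses
    that are already instantiated. The bound [N] provides the fresh names that (A2) asks for. *)
Definition entailment_stable s : Prop := forall N F e,
  F `|` [set e] `<=` @frozen_goal Sg -> names_below N (F `|` [set e]) ->
  ent (E `|` F) e -> ent (E `|` fsubst s @` F) (fsubst s e).

(** The constants of [l] are substituted one after the other; each such substitution is grounding,
    so the same [N] remains a bound throughout. *)
Lemma entailment_stable_restrict s l :
  (forall a n, (a, n) \in l -> ground_ctor (s a n) /\
     entailment_stable (upd Frz n (s a n))) ->
  entailment_stable (restrict s l).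
Proof.
elim: l => [_|[a n] l IH sl] N F e fr bd en.
  have -> : restrict s [::] = Frz by [].
  rewrite fsubst_Frz; apply: (ent_mono entP) en; apply: setUS => f Ff.
  by exists f => //; rewrite fsubst_Frz.
have [ga sa] : ground_ctor (s a n) /\ entailment_stable (upd Frz n (s a n)).
  by apply: sl; rewrite inE eqxx.
have gr := grounding_upd n ga.
rewrite -restrict_cons // -fsubst_comp.
apply: (ent_mono entP) (_ : E `|` fsubst (restrict s l) @`
  (fsubst (upd Frz n (s a n)) @` F) `<=` _) _.
  by apply: setUS => _ [_ [f Ff <-] <-]; exists f => //; rewrite fsubst_comp.
apply: (IH _ N).
- by move=> b m bl; apply: sl; rewrite inE bl orbT.
- move=> _ [[f Ff <-]|->]; apply: frozen_goal_grounding => //.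
    by apply: fr; left.
  by apply: fr; right.
- move=> _ [[f Ff <-]|->] x /(occ_grounding gr); apply: bd.
    by left.
  by right.
- exact: sa N F e fr bd en.
Qed.

(* Substituting c(t_1, ..., t_n) for y amounts to a derivative delta_{c,y}
   followed by the substitution of each t_i for the i-th fresh variable. *)
Lemma entailment_stable_upd m a (u : term a) :
  ground_ctor u -> entailment_stable (upd Frz m u).
Proof.
move=> gu; elim: gu m => {a u} c ts cc gts IH m N F e fr bd en.
(* These names are distinct and lie above every name of [F] and [e]. *)
pose ys (i : 'I_(arity c)) := N + i.
have inj : injective (fun i => (dom i, ys i) : var Sg).
  by move=> i j [_ /addnI h]; exact: val_inj.
have out f i : (F `|` [set e]) f -> ~ occ f (dom i, ys i).
  by move=> Ff /(bd f Ff) /=; rewrite /ys ltnNge leq_addr.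
have frs f : (F `|` [set e]) f -> fresh ys (occ f) by move=> Ff; split=> // i; exact: out.
pose th := upds Frz ys ts.
pose l := [seq (dom i, ys i) | i <- enum 'I_(arity c)].
have lP i : (dom i, ys i) \in l by apply: map_f; rewrite mem_enum.
have thE f : (F `|` [set e]) f ->
    fsubst (restrict th l) (deriv m ys f) = fsubst (upd Frz m (App ts)) f.
  move=> Ff; rewrite -(deriv_upds (s := upd Frz m (App ts)) (y := m) (ts := ts) (frs f Ff)) ?upd_eq //.
  rewrite !fsubst_comp; apply: eq_in_fsubst => b n; rewrite /subst_then.
  case: updP => [_|{}b {}n ne bf] /=.
    congr App; apply: functional_extensionality_dep => i.
    by rewrite /restrict lP /th !upds_in.
  have no i : (dom i, ys i) <> (b, n) :> var Sg.
    by move=> eb; apply: (out f i Ff); rewrite eb; right.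
  rewrite upds_out // upd_neq // /restrict; case: ifP => // /mapP[i _ eb].
  by case: (no i).
rewrite -thE; last by right.
apply: (ent_mono entP) (_ : E `|` fsubst (restrict th l) @` (deriv m ys @` F) `<=` _) _.
  by apply: setUS => _ [_ [f Ff <-] <-]; exists f => //; rewrite thE //; left.
(* The derivative has introduced names from [N] up to, but excluding, [N + arity c]. *)
apply: (@entailment_stable_restrict _ _ _ (N + arity c)).
- by move=> b n /mapP[i _ [-> ->]]; rewrite /th upds_in.
- move=> _ [[f Ff <-]|->]; apply: frozen_goal_deriv.
  + by apply: fr; left.
  + by apply: frs; left.
  + by apply: fr; right.
  + by apply: frs; right.
- have dn f x : (F `|` [set e]) f -> occ (deriv m ys f) x -> x.2 < N + arity c.
    move=> Ff /occ_fsubst[|/(bd f Ff)|[b [n [fb /tfvars_deriv[->|[i ->]]]]]].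
    + by move=> b n; exact: tvars_deriv.
    + by move=> h; apply: leq_trans h _; exact: leq_addr.
    + by apply: leq_trans (bd f Ff (b, n) _) _; [right|exact: leq_addr].
    + by rewrite /= /ys ltn_add2l.
  move=> _ [[f Ff <-]|->] x; apply: dn; by [left|right].
- apply: (ent_A2 entP EP (G := [set e])) => //.
  + by move=> f Ff; apply: fr; left.
  + by move=> f Ff; apply: fr; right.
  + by split=> // i [f Ff]; exact: out.
  + by move=> _ ->.
  + by exists e.
Qed.

Lemma ent_drop_frozen F e :
  F `<=` @frozen_goal Sg -> (forall f, F f -> FVar f !=set0) ->
  frozen_goal e -> FVar e = set0 -> ent (E `|` F) e -> ent E e.
Proof.
move=> fF nF /frozen_goalP[fin vs _] e0.
pose g := Goal set0 (qvars e) (concl e) (cond e).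
have gwf : wf_goal g.
  by split=> //=; rewrite ?set0I ?set0U //; exact: finite_set0.
have ge : as_sentence g = e by rewrite /as_sentence /= set0U; case: (e).
have fe : freeze g = e.
  rewrite -[RHS]fsubst_Frz /freeze /inst.
  suff -> : on_indv g Frz = Var by [].
  apply: functional_extensionality_dep => a; apply: functional_extensionality_dep => n.
  by rewrite /on_indv ifN // notin_setE.
rewrite -{1}fe -ge.
by case: (ent_A1 entP EP fF nF gwf erefl) => h _ /h.
Qed.

(** * Soundness by induction on the weight of an instance *)

Fixpoint tsize a (t : term (Sg := Sg) a) : nat :=
  if t is App f ts then (\sum_(i < arity f) tsize (ts i)).+1 else 1.

Definition weight s (l : seq (Defs.sort Sg * nat)) : nat :=
  \sum_(x <- l) tsize (s x.1 x.2).

Lemma weight_filter s (P : pred (Defs.sort Sg * nat)) a y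
    (l : seq (Defs.sort Sg * nat)) :
  (a, y) \in l -> ~~ P (a, y) ->
  tsize (s a y) + weight s (filter P l) <= weight s l.
Proof.
move=> yl nP; rewrite /weight big_filter [leqRHS](bigID P) /= addnC leq_add2l.
by rewrite (big_rem (a, y)) //= nP leq_addr.
Qed.

Lemma eq_in_weight r s l :
  (forall a n, (a, n) \in l -> r a n = s a n) -> weight r l = weight s l.
Proof.
by move=> rs; rewrite /weight; apply: eq_big_seq => -[a n] /rs /= ->.
Qed.

(** What [Derive] guarantees for its goal, once [A] collects the goals met in the run. *)
Definition derived_into (A : set (sentence Sg)) e : Prop :=
  exists2 nu, fresh_choice nu e & Delta nu e `<=` A.

Definition ground_on s (l : seq (Defs.sort Sg * nat)) : Prop :=
  forall a n, (a, n) \in l -> ground_ctor (s a n).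

Definition sound_below (A : set (sentence Sg)) k : Prop := forall e s l,
  A e -> FVar e `<=` [set` l] -> ground_on s l -> weight s l < k ->
  ent E (fsubst s e).

(* Peeling one constructor off an instance of e0 exhibits it as a strictly
   lighter instance of a derivative of e0. *)
Lemma sound_derived A k e0 s l :
  sound_below A k -> derived_into A e0 -> FVar e0 !=set0 ->
  FVar e0 `<=` [set` l] -> ground_on s l -> weight s l <= k ->
  ent E (fsubst s e0).
Proof.
move=> IH [nu nuP nuA] [[a y] ya] fl gl wl.
(* Abstracting the sort and the term permits the dependent case analysis on [ground_ctor]. *)
have key b (t : term b) : ground_ctor t -> FVar e0 (b, y) -> s b y = t ->
    ent E (fsubst s e0).
  case=> c ts cc gts {ya}yc sy.
  have fr := nuP c y cc yc; have [inj out] := fr.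
  rewrite -(deriv_upds (s := s) (y := y) (ts := ts) fr) //.
  (* Entries outside [FVar e0] are discarded too: one of them could be a fresh name, whose value
     [upds] changes. *)
  pose P (x : Defs.sort Sg * nat) := (x != (cod c, y)) && (x \in FVar e0).
  pose ysl := [seq (dom i, nu c y i) | i <- enum 'I_(arity c)].
  have same b' n : FVar e0 (b', n) -> upds s (nu c y) ts b' n = s b' n.
    by move=> h; apply: upds_out => i eb; case: (out i); rewrite eb; right.
  apply: (IH _ _ (filter P l ++ ysl)).
  - by apply: nuA; left; exists c, y.
  - move=> x /FVar_fsubst[b' [n [bn]]] /=.
    rewrite mem_cat mem_filter.
    have := bn; case: updP => [_|{}b' {}n ne {}bn] /=.
      by case=> i _ ->; rewrite map_f ?orbT // mem_enum.
    by move=> ->; rewrite /P mem_set // andbT fl //; move/eqP: ne => ->.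
  - move=> b' n; rewrite mem_cat mem_filter => /orP[|/mapP[i _ [-> ->]]].
      by case/andP=> /andP[_ /set_mem h] bl; rewrite same //; exact: gl.
    by rewrite upds_in.
  - have nP : ~~ P (cod c, y) by rewrite /P eqxx.
    (* The head constructor [c] counts for 1 in the size of [s (cod c) y]; losing it makes the
       decrease strict. *)
    have := weight_filter s (fl _ yc) nP; rewrite sy /= => w.
    apply: leq_trans wl; apply: leq_trans w; rewrite addSn ltnS.
    rewrite {1}/weight big_cat /= addnC leq_add //.
      rewrite big_map big_enum /= leq_eqVlt; apply/orP; left; apply/eqP.
      by apply: eq_bigr => i _; rewrite upds_in.
    rewrite -/(weight _ _) (@eq_in_weight _ s) // => b' n.
    by rewrite mem_filter => /andP[/andP[_ /set_mem h] _]; exact: same.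
exact: (key _ _ (gl a y (fl _ ya)) ya).
Qed.

(** The form of the hypotheses added by [Derive], with the freshness of the incarnation [y']
    recorded. *)
Definition incarnated_hypothesis (A : set (sentence Sg)) f : Prop :=
  exists a y' y e0, [/\ derived_into A e0, FVar e0 (a, y), ~ occ e0 (a, y')
    & f = rename a y' y e0].

(** Instantiating [e0[y'/y]] by [s] amounts to instantiating [e0] with the value of [y'] given to
    [y]. The weight does not grow, since [y] takes the place of [y'], and [sound_derived] applies to
    [e0]. *)
Lemma sound_hypothesis A k f s l :
  sound_below A k -> incarnated_hypothesis A f ->
  FVar f `<=` [set` l] -> ground_on s l -> weight s l <= k ->
  ent E (fsubst s f).
Proof.
move=> IH [a [y' [y [e0 [de ya ny ->]]]]] fl gl wl.
have ne : (a, y') <> (a, y) by move=> h; apply: ny; rewrite h; right.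
have yl : (a, y') \in l.
  by apply: fl; apply/FVar_fsubst; exists a, y; split=> //; rewrite upd_eq.
pose s0 := upd s y (s a y').
(* The old entry of [y] goes as well: its value under [s] is replaced in [s0]. *)
pose P (x : Defs.sort Sg * nat) := (x != (a, y')) && (x != (a, y)).
have -> : fsubst s (rename a y' y e0) = fsubst s0 e0.
  rewrite fsubst_comp; apply: eq_in_fsubst => b n; rewrite /subst_then /s0.
  by case: updP => [|{}b {}n bn] _ /=; rewrite ?upd_eq ?upd_neq.
have s0E b n : P (b, n) -> s0 b n = s b n.
  by move=> /andP[_ /eqP h]; rewrite /s0 upd_neq.
apply: (sound_derived (l := (a, y) :: filter P l) IH de).
- by exists (a, y).
- move=> [b n] bn /=; rewrite inE mem_filter /P.
  have [//|nb] /= := eqVneq (b, n) (a, y); rewrite andbT.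
  apply/andP; split; first by apply/eqP => h; apply: ny; rewrite -h; right.
  apply: fl; apply/FVar_fsubst; exists b, n; split=> //.
  by rewrite upd_neq //; apply/eqP.
- move=> b n; rewrite inE => /orP[/eqP[-> ->]|].
    by rewrite /s0 upd_eq; exact: gl.
  by rewrite mem_filter => /andP[/s0E -> ?]; exact: gl.
- apply: leq_trans wl; rewrite /weight big_cons /= {1}/s0 upd_eq -/(weight _ _).
  rewrite (@eq_in_weight _ s) => [|b n]; last by rewrite mem_filter => /andP[/s0E].
  by apply: weight_filter => //; rewrite /P eqxx.
Qed.

(** The circularity is harmless because goals and hypotheses both reach the induction hypothesis
    through [sound_derived], where the weight strictly decreases. *)
Lemma sound_goals A Fn N :
  A `<=` @frozen_goal Sg -> Fn `<=` @frozen_goal Sg -> names_below N Fn ->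
  (forall f, Fn f -> incarnated_hypothesis A f) ->
  (forall e, A e ->
     ent (E `|` Fn) e \/ FVar e !=set0 /\ derived_into A e) ->
  forall k, sound_below A k.
Proof.
move=> frA frF bd FA AP; elim=> // k IH e s l Ae fl gl; rewrite ltnS => wl.
case: (AP e Ae) => [en|[ne de]]; last exact: (sound_derived IH de ne fl gl wl).
(* With an exact list of the constants of [e], the restriction [r] leaves all other constants of the
   hypotheses frozen. *)
have /(@finite_seqP (Defs.sort Sg * nat)%type)[l' el'] := FVar_finite e.
have gl' : ground_on s l'.
  move=> a n an; apply: gl; have : FVar e (a, n) by rewrite el'.
  exact: fl.
pose r := restrict s l'.
have gr : grounding r.
  by move=> a n; rewrite /r /restrict; case: ifP => [/gl'|]; [right|left].
have -> : fsubst s e = fsubst r e.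
  by apply: eq_in_fsubst => b n; rewrite el' /= /r /restrict => ->.
have re0 : FVar (fsubst r e) = set0.
  apply/seteqP; split=> // x /FVar_fsubst[b [n []]]; rewrite el' /= => bn.
  by rewrite /r /restrict bn; have [_ ->] := ground_ctor_closed (gl' _ _ bn).
have [M eM] := finite_names_below (frozen_goal_occ_finite (frA e Ae)).
have ren : ent (E `|` fsubst r @` Fn) (fsubst r e).
  (* A common bound for the names of [Fn] and those of [e]. *)
  apply: (entailment_stable_restrict _ (N := maxn N M)) en.
  - by move=> a n /gl' ga; split=> //; exact: entailment_stable_upd.
  - by move=> f [/frF|->] //; exact: frA.
  - move=> f [Ff|->] x xo; rewrite leq_max.
      by rewrite (bd f Ff x xo).
    by rewrite (eM x xo) orbT.
pose K := [set f | (fsubst r @` Fn) f /\ FVar f !=set0].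
apply: (@ent_drop_frozen K).
- by move=> _ [[f Ff <-] _]; apply: frozen_goal_grounding => //; exact: frF.
- by move=> f [].
- by apply: frozen_goal_grounding => //; exact: frA.
- exact: re0.
apply: (ent_trans entP) ren => h [Eh|Fh].
  by apply: (ent_mono entP) (ent_refl entP h) => _ ->; left.
have [nh|/set0P/negP/negPn/eqP h0] := pselect (FVar h !=set0).
  by apply: (ent_mono entP) (ent_refl entP h) => _ ->; right.
apply: (ent_mono entP (E := E)); first by move=> ?; left.
case: Fh h0 => f Ff <- h0.
(* A constant of [f] outside [l'] would survive [r], but [fsubst r f] has no frozen constant. *)
have fl' x : FVar f x -> x \in l'.
  case: x => b n fb; apply: contrapT => /negP bl.
  have : FVar (fsubst r f) (b, n).
    by apply/FVar_fsubst; exists b, n; split=> //; rewrite /r /restrict (negPf bl).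
  by rewrite h0.
have -> : fsubst r f = fsubst s f.
  by apply: eq_in_fsubst => b n /fl' bl; rewrite /r /restrict bl.
apply: (sound_hypothesis IH (FA f Ff)) gl wl => x /fl' xl.
by apply: fl; rewrite el'.
Qed.

End Entailment.
End FrozenSubstitution.

(** * Invariants of a run of the proof system *)

Section Run.
Variables (B : specification) (ent : set (sentence B) -> sentence B -> Prop).
Hypothesis entP : contextual_entailment ent.
Implicit Types (nu : name_choice B) (e : sentence B).

Lemma incarnation_fresh nu e a y' y :
  fresh_choice nu e -> incarnation nu (a, y') (a, y) -> FVar e (a, y) ->
  ~ occ e (a, y').
Proof.
move=> nuP [c [m [i [cc -> -> _]]]] ya.
by case: (nuP c m cc ya) => _; exact.
Qed.

Lemma hypotheses_incarnated A nu e FV :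
  fresh_choice nu e -> Delta nu e `<=` A ->
  hypotheses nu e FV `<=` incarnated_hypothesis A.
Proof.
move=> nuP nuA _ [a [y' [y [inc _ ya ->]]]]; exists a, y', y, e; split=> //.
  by exists nu.
exact: incarnation_fresh nuP inc ya.
Qed.

Lemma frozen_goal_Delta nu e :
  frozen_goal e -> fresh_choice nu e -> Delta nu e `<=` @frozen_goal B.
Proof.
move=> fe nuP e' [[c [y [cc yc ->]]]|[_ ->] //].
by apply: frozen_goal_deriv => //; exact: nuP.
Qed.

Definition bounded_frozen (F : set (sentence B)) : Prop :=
  F `<=` @frozen_goal B /\ exists N, names_below N F.

Lemma bounded_frozenU F F' :
  bounded_frozen F -> bounded_frozen F' -> bounded_frozen (F `|` F').
Proof.
move=> [fF [N NF]] [fF' [N' NF']]; split; first by move=> e [/fF|/fF'].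
exists (maxn N N') => e [/NF h|/NF' h] x /h; rewrite leq_max => -> //.
exact: orbT.
Qed.

(** Infinitely many constructors could produce unboundedly many incarnations; finiteness of
    [Delta nu e] leaves only finitely many constants for [y']. *)
Lemma bounded_hypotheses nu e :
  frozen_goal e -> fresh_choice nu e -> finite_set (Delta nu e) ->
  bounded_frozen (hypotheses nu e (\bigcup_(e' in Delta nu e) FVar e')).
Proof.
move=> fe nuP fin; split.
  move=> _ [a [y' [y [inc _ ya ->]]]]; apply: frozen_goal_rename => // qy.
  by apply: (incarnation_fresh nuP inc ya); left; left.
set FV := \bigcup_(_ in _) _.
have [N NP] : exists N, forall x, (occ e `|` FV) x -> x.2 < N.
  apply: finite_names_below; rewrite finite_setU; split.
    exact: frozen_goal_occ_finite.
  by apply: bigcup_finite => // e' _; exact: FVar_finite.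
exists N => _ [a [y' [y [inc yFV ya ->]]]] x.
case/occ_fsubst => [b n|xo|[b [n [bn]]]]; first by case: updP.
  by apply: NP; left.
move: bn; case: updP => [_ ->|{}b {}n _ bn ->]; apply: NP; first by right.
by left; right.
Qed.

(* No step removes more than one goal, so a run that ends without goals only
   goes through finite sets of goals: this bounds the names in [Fn]. *)
Lemma steps_invariant F G Fn : steps ent (F, G) (Fn, set0) ->
  G `<=` @frozen_goal B ->
  [/\ finite_set G, F `<=` Fn, bounded_frozen F -> bounded_frozen Fn
    & exists A : set (sentence B),
      [/\ G `<=` A, A `<=` @frozen_goal B,
          forall f, Fn f -> F f \/ incarnated_hypothesis A f
        & forall e, A e -> ent (eqns (s := B) `|` Fn) e \/
            FVar e !=set0 /\ derived_into A e]].
Proof.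
move eC: (F, G) => C; move eC': (Fn, set0) => C' st.
elim: st F G eC eC' => {C C'} [C|C C' C'' st _ IH] F G eC eC' frG.
  move: eC'; rewrite -eC => -[<- <-]; split=> //.
  (* [A] collects the goals from the current configuration to the end; at the end there are none. *)
  by exists set0; split=> // f; left.
have derived_intoS (A A' : set (sentence B)) e :
    A `<=` A' -> derived_into A e -> derived_into A' e.
  by move=> sA [nu h1 h2]; exists nu => // x /h2 /sA.
have incarnatedS (A A' : set (sentence B)) f :
    A `<=` A' -> incarnated_hypothesis A f -> incarnated_hypothesis A' f.
  move=> sA [a [y' [y [e0 [h1 h2 h3 h4]]]]]; exists a, y', y, e0; split=> //.
  exact: derived_intoS h1.
case: st eC IH => [F' G' e en|F' G' e nu nuP _] [-> eG] IH; rewrite {}eG in frG *.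
  have [|fin sF bF [A [GA fA FA AP]]] := IH _ _ erefl eC'.
    by move=> x h; apply: frG; left.
  split=> //; first by rewrite finite_setU; split=> //; exact: finite_set1.
  have sA : A `<=` A `|` [set e] by move=> ?; left.
  exists (A `|` [set e]); split.
  - by move=> x [/GA|]; [left|right].
  - by move=> x [/fA|->] //; apply: frG; right.
  - by move=> f /FA[|/(incarnatedS _ _ _ sA)]; [left|right].
  - move=> x [/AP[|[ne /(derived_intoS _ _ _ sA)]]|->]; [by left|by right|left].
    (* Hypotheses only accumulate, so a reduced goal still follows from the final ones. *)
    by apply: (ent_mono entP) en; exact: setUS.
have fe : frozen_goal e by apply: frG; right.
have [|fin sF bF [A [GA fA FA AP]]] := IH _ _ erefl eC'.
  by move=> x [h|]; [apply: frG; left|exact: frozen_goal_Delta].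
move: fin; rewrite finite_setU => -[finG finD].
have DA : Delta nu e `<=` A by move=> x h; apply: GA; right.
split.
- by rewrite finite_setU; split=> //; exact: finite_set1.
- by move=> x h; apply: sF; left.
- by move=> h; apply: bF; apply: bounded_frozenU => //; exact: bounded_hypotheses.
have sA : A `<=` A `|` [set e] by move=> ?; left.
exists (A `|` [set e]); split.
- by move=> x [h|]; [left; apply: GA; left|right].
- by move=> x [/fA|->].
- move=> f /FA[[h|]|/(incarnatedS _ _ _ sA)]; [by left| |by right].
  by move=> h; right; apply: incarnatedS sA _; exact: hypotheses_incarnated h.
- move=> x [/AP[|[ne /(derived_intoS _ _ _ sA)]]|->]; [by left|by right|].
  have [ne|/set0P/negP/negPn/eqP e0] := pselect (FVar e !=set0).
    by right; split=> //; apply: derived_intoS sA _; exists nu.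
  (* A goal without frozen constants is its own derivative: it is still present after the step, and
     the rest of the run handles it. *)
  have /AP[|[ne /(derived_intoS _ _ _ sA)]] : A e by apply: DA; right.
    by left.
  by right.
Qed.

End Run.

Theorem theorem3 (B : specification)
    (ent : set (sentence B) -> sentence B -> Prop)
    (entP : contextual_entailment ent)
    (G : set (goal B)) (GP : forall g, G g -> inductive_goal g)
    (Fn : set (sentence B))
    (deriv_G : steps ent (set0, @freeze B @` G) (Fn, set0)) :
  forall g, G g -> inductively_satisfies ent g.
Proof.
move=> g Gg th thP.
have frG : @freeze B @` G `<=` @frozen_goal B.
  by move=> _ [h /GP[hwf _] <-]; exists h.
have [_ _ bF [A [GA fA FA AP]]] := steps_invariant entP deriv_G frG.
have [fF [N NF]] : bounded_frozen Fn by apply: bF; split=> //; exists 0.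
have {}FA f : Fn f -> incarnated_hypothesis A f by case/FA.
have [gwf _] := GP g Gg.
have /(@finite_seqP (Defs.sort B * nat)%type)[l el] := FVar_finite (freeze g).
rewrite inst_fsubst //.
(* The successor meets the strict bound in [sound_below]. *)
apply: (sound_goals entP (@eqnsP B) fA fF NF FA AP (l := l) (k := (weight th l).+1)) => //.
- by apply: GA; exists g.
- by rewrite el.
- move=> a n an; apply: thP; have : FVar (freeze g) (a, n) by rewrite el.
  by rewrite FVar_freeze // => -[].
Qed.
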